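(* Let $\Omega=\bigcup_{i=1}^n(\alpha_i,\beta_i)$ with $-\infty<\alpha_1<\beta_1<\alpha_2<\beta_2<\dots<\alpha_n<\beta_n<\infty$. Assume $\Omega$ is spectral with spectrum $\Lambda$ of period $p$, and assume in addition that $0\in\Lambda$. Let $B=(b_{ij})_{i,j=1}^n$ be the spectral unitary matrix associated to $\Lambda$. Then there exists a permutation $\sigma$ of the set $\{1,\dots,n\}$ with the property that $\beta_i\equiv_p\alpha_{\sigma(i)}$ for all $i=1,\dots,n$. The matrix $B$ has the following properties: (i) $b_{ij}=0$ if $\alpha_j\not\equiv_p\beta_i$. (ii) $\sum_{j:\alpha_j\equiv_p\beta_i}b_{ij}=1$ for all $i=1,\dots,n$. (iii) $\sum_{i:\beta_i\equiv_p\alpha_j}b_{ij}=1$ for all $j=1,\dots,n$. (iv) For every $\lambda\in\Lambda$, $\sum_{j:\alpha_j\equiv_p\beta_i}e^{-2\pi \mathrm{i}(\beta_i-\alpha_j)\lambda}b_{ij}=1$ for all $i=1,\dots,n$. (v) For every $\lambda\in\Lambda$, $\sum_{i:\beta_i\equiv_p\alpha_j}e^{-2\pi \mathrm{i}(\beta_i-\alpha_j)\lambda}b_{ij}=1$ for all $j=1,\dots,n$. (vi) There is no proper subset $I$ of $\{1,\dots,n\}$, $I\ne\emptyset$, $I\neq\{1,\dots,n\}$, with the property that for all $i\in I$, $j\notin I$, $\beta_i\not\equiv_p\alpha_j$.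
   Context: $\mathrm{i}$ (upright) is the imaginary unit; $i$ is an index. $e_\lambda(x)=e^{2\pi \mathrm{i}\lambda x}$. $\Omega$ is spectral with spectrum $\Lambda\subset\mathbb{R}$ if $\{|\Omega|^{-1/2}e_\lambda:\lambda\in\Lambda\}$ is an orthonormal basis of $L^2(\Omega)$. $\Lambda$ has period $p\in\mathbb{R}\setminus\{0\}$ if $\Lambda+p=\Lambda$. For $t,s\in\mathbb{R}$, $t\equiv_ps$ means $p(t-s)\in\mathbb{Z}$. The spectral unitary matrix associated to $\Lambda$: let $A$ be the self-adjoint operator on $L^2(\Omega)$ that is diagonal in the basis $\{e_\lambda\}_{\lambda\in\Lambda}$ with $Ae_\lambda=\lambda e_\lambda$. It is a self-adjoint extension of $\mathsf{D}=\frac{1}{2\pi \mathrm{i}}\frac{d}{dx}$ on $C_c^\infty(\Omega)$, and there is a unique $n\times n$ unitary matrix $B$ such that $\operatorname{domain}(A)=\{f\in\mathcal{D}_{\max}:Bf(\alpha)=f(\beta)\}$; this $B$ is the matrix associated to $\Lambda$. Here $\mathcal{D}_{\max}=\{f\in L^2(\Omega):f$ absolutely continuous on each $(\alpha_i,\beta_i)$, $f'\in L^2(\Omega)\}$, and $f(\alpha)=(f(\alpha_i))_{i=1}^n$, $f(\beta)=(f(\beta_i))_{i=1}^n$ are the vectors of one-sided limits at the endpoints from inside the intervals. *)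

(* Defs.v *)
From HB Require Import structures.
From mathcomp Require Import all_boot all_order all_fingroup all_algebra.
From mathcomp Require Import complex.
From mathcomp Require Import all_classical all_reals all_analysis.

Set Implicit Arguments.
Unset Strict Implicit.
Unset Printing Implicit Defensive.

Import Order.TTheory GRing.Theory Num.Theory.
Import numFieldNormedType.Exports.

Local Open Scope classical_set_scope.
Local Open Scope ring_scope.
Local Open Scope complex_scope.

Local Notation Re := complex.Re.
Local Notation Im := complex.Im.

Definition expi (R : realType) (t : R) : R[i] := cos t +i* sin t.

Definition expe (R : realType) (l x : R) : R[i] := expi (2 * pi * l * x).

Definition cmod2 (R : realType) (z : R[i]) : R := Re z ^+ 2 + Im z ^+ 2.

Definition cmod (R : realType) (z : R[i]) : R := Num.sqrt (cmod2 z).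

(* Elements of L^2(O) are represented by functions on the whole line, of which
   only the values on O matter, up to Lebesgue-null sets.  The library's sigma
   algebra on R is the Borel one, so representatives are Borel on O. *)
Definition L2 (R : realType) (O : set R) (f : R -> R[i]) : Prop :=
  [/\ measurable_fun O (fun x => Re (f x)),
      measurable_fun O (fun x => Im (f x)) &
      (\int[@lebesgue_measure R]_(x in O) (cmod2 (f x))%:E < +oo)%E].

(* Linear in the first variable, conjugate linear in the second. *)
Definition inner (R : realType) (O : set R) (f g : R -> R[i]) : R[i] :=
  Rintegral (@lebesgue_measure R) O (fun x => Re (f x * (g x)^*%C))
  +i* Rintegral (@lebesgue_measure R) O (fun x => Im (f x * (g x)^*%C)).

Definition L2norm (R : realType) (O : set R) (f : R -> R[i]) : R :=
  Num.sqrt (Rintegral (@lebesgue_measure R) O (fun x => cmod2 (f x))).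

Definition orthonormal_basis (R : realType) (O L : set R)
    (F : R -> R -> R[i]) : Prop :=
  [/\ forall l, L l -> L2 O (F l),
      forall l m, L l -> L m -> inner O (F l) (F m) = (l == m)%:R &
      forall f, L2 O f -> forall eps : R, 0 < eps ->
        exists (s : seq R) (c : R -> R[i]),
          (forall l, l \in s -> L l) /\
          L2norm O (fun x => f x - \sum_(l <- s) c l * F l x) < eps].

Definition spectrum (R : realType) (O L : set R) : Prop :=
  orthonormal_basis O L (fun l x =>
    ((Num.sqrt (fine (lebesgue_measure O)))^-1)%:C * expe l x).

Definition has_period (R : realType) (L : set R) (p : R) : Prop :=
  p != 0 /\ [set l + p | l in L] = L.

Definition eqv (R : realType) (p t s : R) : bool := p * (t - s) \is a Num.int.

(* An operator in L^2(O) is given by its graph: A f g means that f is in the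
   domain of A and A f = g. *)
Definition op_graph (R : realType) := (R -> R[i]) -> (R -> R[i]) -> Prop.

Definition op_domain (R : realType) (A : op_graph R) (f : R -> R[i]) : Prop :=
  exists g, A f g.

Definition densely_defined (R : realType) (O : set R) (A : op_graph R) : Prop :=
  forall f, L2 O f -> forall eps : R, 0 < eps ->
    exists2 u, op_domain A u & L2norm O (fun x => f x - u x) < eps.

Definition adjoint (R : realType) (O : set R) (A : op_graph R) : op_graph R :=
  fun f g => [/\ L2 O f, L2 O g &
    forall u v, A u v -> inner O v f = inner O u g].

(* The equality A = A^* makes A a linear relation compatible with a.e. equality
   on O, and density of the domain makes it single-valued up to a.e. equality. *)
Definition self_adjoint (R : realType) (O : set R) (A : op_graph R) : Prop :=
  densely_defined O A /\ (forall f g, A f g <-> adjoint O A f g).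

Definition diagonal_operator (R : realType) (O L : set R) (A : op_graph R)
    : Prop :=
  self_adjoint O A /\
  (forall l, L l -> A (expe l) (fun x => l%:C * expe l x)).

Definition abs_continuous_itvoo (R : realType) (a b : R) (f : R -> R[i])
    : Prop :=
  forall eps : R, 0 < eps -> exists2 delta : R, 0 < delta &
    forall (m : nat) (s t : 'I_m -> R),
      (forall k, [/\ a < s k, s k <= t k & t k < b]) ->
      (forall k l, k != l -> t k <= s l \/ t l <= s k) ->
      \sum_k (t k - s k) < delta ->
      \sum_k cmod (f (t k) - f (s k)) < eps.

Definition Omega (R : realType) (n : nat) (al be : 'I_n -> R) : set R :=
  \bigcup_(i in [set: 'I_n]) [set x | al i < x < be i].

Definition Dmax (R : realType) (n : nat) (al be : 'I_n -> R) (f : R -> R[i])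
    : Prop :=
  [/\ L2 (Omega al be) f,
      forall i, abs_continuous_itvoo (al i) (be i) f &
      exists2 f', L2 (Omega al be) f' &
        {ae @lebesgue_measure R, forall x, Omega al be x ->
          is_derive x 1 (fun y => Re (f y)) (Re (f' x)) /\
          is_derive x 1 (fun y => Im (f y)) (Im (f' x))}].

Definition right_lim (R : realType) (f : R -> R[i]) (a : R) : R[i] :=
  lim (Re (f x) @[x --> a^'+]) +i* lim (Im (f x) @[x --> a^'+]).

Definition left_lim (R : realType) (f : R -> R[i]) (b : R) : R[i] :=
  lim (Re (f x) @[x --> b^'-]) +i* lim (Im (f x) @[x --> b^'-]).

(* The domain of A is a set of a.e. classes, each of which is required to have
   a representative in D_max satisfying the boundary condition. *)
Definition domain_matrix (R : realType) (n : nat) (al be : 'I_n -> R)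
    (A : op_graph R) (B : 'M[R[i]]_n) : Prop :=
  forall f, L2 (Omega al be) f ->
    (op_domain A f <->
     exists g, [/\ Dmax al be g,
       B *m (\col_i right_lim g (al i)) = \col_i left_lim g (be i) &
       {ae @lebesgue_measure R, forall x, Omega al be x -> f x = g x}]).

Definition spectral_matrix (R : realType) (n : nat) (al be : 'I_n -> R)
    (L : set R) (B : 'M[R[i]]_n) : Prop :=
  exists A : op_graph R,
    [/\ diagonal_operator (Omega al be) L A,
        B \is unitarymx & domain_matrix al be A B].

(* Main.v *)
(* Since e_l lies in the domain of A for l in L, and its representative in D_max
   is continuous on each interval, B e_l(al) = e_l(be) for every l in L.
   Conversely the density of the span of the e_l forces the vectors e_l(al) to
   span C^n: if w is orthogonal to all of them, one solves a linear system for a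
   function h = c_i exp(-x) on the i-th interval whose boundary terms, hence
   whose inner products with all e_l, vanish; so h = 0 and w = 0.
   As e_(l+p) = e_l e_p, comparing B e_l(al) = e_l(be) at l and l + p on this
   spanning set gives B diag(e_p(al)) = diag(e_p(be)) B, which is (i).  Then
   (ii)-(v) are B e_l(al) = e_l(be) and its adjoint form, and the permutation is
   read off a nonzero term of det B.  An isolated set I as in (vi) would make B
   block diagonal, so that some nonconstant function, constant on each interval,
   has vanishing boundary terms and mean zero; it is orthogonal to all e_l,
   which is absurd. *)
Require Import Defs.
From HB Require Import structures.
From mathcomp Require Import all_boot all_order all_fingroup all_algebra.
From mathcomp Require Import complex.
From mathcomp Require Import all_classical all_reals all_analysis.
From mathcomp Require Import measurable_realfun ring lra.

Set Implicit Arguments.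
Unset Strict Implicit.
Unset Printing Implicit Defensive.

Import Order.TTheory GRing.Theory Num.Theory.
Import numFieldNormedType.Exports.

Local Open Scope classical_set_scope.
Local Open Scope ring_scope.
Local Open Scope complex_scope.

Local Notation Re := complex.Re.
Local Notation Im := complex.Im.
Local Notation expe := Defs.expe.

(** * Integrals of bounded measurable complex functions *)

Section BoundedMeasurable.
Context {R : realType} {O : set R}.
Local Notation mu := (@lebesgue_measure R).

(** On a set of finite measure this implies integrability, and unlike integrability it is stable
    under products. *)
Definition bmeas (f : R -> R) :=
  measurable_fun O f /\ exists M, forall x, O x -> `|f x| <= M.

Lemma bmeasD f g : bmeas f -> bmeas g -> bmeas (f \+ g).
Proof.
move=> [mf [M hM]] [mg [N hN]]; split; first exact: measurable_funD.
exists (M + N) => x Ox; apply: le_trans (ler_normD _ _) _.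
by apply: lerD; [exact: hM|exact: hN].
Qed.

Lemma bmeasM f g : bmeas f -> bmeas g -> bmeas (f \* g).
Proof.
move=> [mf [M hM]] [mg [N hN]]; split; first exact: measurable_funM.
exists (M * N) => x Ox; rewrite normrM.
by apply: ler_pM => //; [exact: hM|exact: hN].
Qed.

Lemma bmeas_cst r : bmeas (fun=> r).
Proof. by split; [exact: measurable_cst|exists `|r|]. Qed.

Lemma bmeasN f : bmeas f -> bmeas (fun x => - f x).
Proof.
move=> [mf [M hM]]; split; first exact: measurableT_comp.
by exists M => x Ox; rewrite normrN; exact: hM.
Qed.

Definition cbmeas (f : R -> R[i]) :=
  bmeas (fun x => Re (f x)) /\ bmeas (fun x => Im (f x)).

Lemma cbmeasD f g : cbmeas f -> cbmeas g -> cbmeas (fun x => f x + g x).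
Proof.
have ReD (z w : R[i]) : Re (z + w) = Re z + Re w by case: z w => [? ?] [? ?].
have ImD (z w : R[i]) : Im (z + w) = Im z + Im w by case: z w => [? ?] [? ?].
move=> [rf jf] [rg jg]; split.
  have := bmeasD rf rg; congr (bmeas _); apply/funext => x /=; exact/esym/ReD.
have := bmeasD jf jg; congr (bmeas _); apply/funext => x /=; exact/esym/ImD.
Qed.

Lemma cbmeasM f g : cbmeas f -> cbmeas g -> cbmeas (fun x => f x * g x).
Proof.
have ReM (z w : R[i]) : Re (z * w) = Re z * Re w + (- (Im z * Im w)).
  by case: z w => [? ?] [? ?].
have ImM (z w : R[i]) : Im (z * w) = Re z * Im w + Im z * Re w.
  by case: z w => [? ?] [? ?].
move=> [rf jf] [rg jg]; split.
  have := bmeasD (bmeasM rf rg) (bmeasN (bmeasM jf jg)).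
  by congr (bmeas _); apply/funext => x /=; rewrite ReM.
have := bmeasD (bmeasM rf jg) (bmeasM jf rg).
by congr (bmeas _); apply/funext => x /=; rewrite ImM.
Qed.

Lemma cbmeasJ f : cbmeas f -> cbmeas (fun x => (f x)^*%C).
Proof.
move=> [rf jf]; split.
  by move: rf; congr (bmeas _); apply/funext => x; case: (f x).
by have := bmeasN jf; congr (bmeas _); apply/funext => x; case: (f x).
Qed.

Lemma cbmeas_cst c : cbmeas (fun=> c).
Proof. by split; exact: bmeas_cst. Qed.

Lemma cbmeas_sum (I : Type) (s : seq I) (F : I -> R -> R[i]) :
  (forall i, cbmeas (F i)) -> cbmeas (fun x => \sum_(i <- s) F i x).
Proof.
move=> FB; elim: s => [|i s IH].
  rewrite (_ : (fun _ => _) = fun=> 0); first exact: cbmeas_cst.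
  by apply/funext => x; rewrite big_nil.
rewrite (_ : (fun _ => _) = fun x => F i x + \sum_(j <- s) F j x).
  exact: cbmeasD.
by apply/funext => x; rewrite big_cons.
Qed.

Hypothesis mO : measurable O.
Hypothesis fO : (mu O < +oo)%E.

Lemma bmeas_integrable f : bmeas f -> mu.-integrable O (EFin \o f).
Proof.
move=> [mf [M hM]]; apply: measurable_bounded_integrable => //.
exists M; split; first exact: num_real.
by move=> N MN x Ox; apply: le_trans (hM _ Ox) (ltW MN).
Qed.

(** [inner O f g] unfolds to this integral of [f] times the conjugate of [g]. *)
Definition cint (f : R -> R[i]) : R[i] :=
  Rintegral mu O (fun x => Re (f x)) +i* Rintegral mu O (fun x => Im (f x)).

Lemma cintD f g : cbmeas f -> cbmeas g ->
  cint (fun x => f x + g x) = cint f + cint g.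
Proof.
move=> [rf jf] [rg jg]; rewrite /cint.
apply/eqP; rewrite eq_complex /= -!RintegralD//;
  try exact: bmeas_integrable.
apply/andP; split; apply/eqP; apply: eq_Rintegral => x _;
  by case: (f x) (g x) => [? ?] [? ?].
Qed.

Lemma cintZ c f : cbmeas f -> cint (fun x => c * f x) = c * cint f.
Proof.
case: c => a b [rf jf]; rewrite /cint.
have IR r g : bmeas g ->
    mu.-integrable O (EFin \o (fun x => r * g x)) by
  move=> gb; apply: bmeas_integrable; apply: bmeasM => //; exact: bmeas_cst.
apply/eqP; rewrite eq_complex /= -!RintegralZl//;
  try exact: bmeas_integrable.
rewrite -RintegralB//; try exact: IR.
rewrite -RintegralD//; try exact: IR.
apply/andP; split; apply/eqP; apply: eq_Rintegral => x _;
  by case: (f x) => [? ?].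
Qed.

Lemma cint_sum (I : Type) (s : seq I) (F : I -> R -> R[i]) :
  (forall i, cbmeas (F i)) ->
  cint (fun x => \sum_(i <- s) F i x) = \sum_(i <- s) cint (F i).
Proof.
move=> FB; elim: s => [|i s IH].
  rewrite (_ : (fun _ => _) = fun=> 0); last first.
    by apply/funext => x; rewrite big_nil.
  by rewrite big_nil /cint Rintegral_cst// mul0r.
rewrite big_cons -IH -cintD//; last exact: cbmeas_sum.
by rewrite /cint; congr (_ +i* _); apply: eq_Rintegral => x _; rewrite big_cons.
Qed.

Lemma bmeas_cmod2 f : cbmeas f -> bmeas (fun x => cmod2 (f x)).
Proof. by move=> [rf jf]; apply: bmeasD; exact: bmeasM. Qed.

(* Pythagoras: [h] orthogonal to [s] gives [|h - s|^2 = |h|^2 + |s|^2]. *)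
Lemma Rintegral_cmod2B_ge h s : cbmeas h -> cbmeas s -> inner O h s = 0 ->
  Rintegral mu O (fun x => cmod2 (h x)) <=
  Rintegral mu O (fun x => cmod2 (h x - s x)).
Proof.
move=> hb sb; rewrite /inner => /eqP; rewrite eq_complex => /andP[/eqP/= h0 _].
have hsb := cbmeasM hb (cbmeasJ sb).
have ZB : bmeas (fun x => -2 * Re (h x * (s x)^*%C)).
  by apply: bmeasM; [exact: bmeas_cst|exact: hsb.1].
(* The cross term of [|h - s|^2] integrates to zero, so it can be added on the left; the integrands
   then differ by [|s|^2] pointwise. *)
have E : Rintegral mu O (fun x => cmod2 (h x)) =
  Rintegral mu O (fun x => cmod2 (h x) + -2 * Re (h x * (s x)^*%C)).
  rewrite RintegralD//; try (apply: bmeas_integrable => //; exact: bmeas_cmod2).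
  rewrite RintegralZl//; last by apply: bmeas_integrable; exact: hsb.1.
  by rewrite h0 mulr0 addr0.
rewrite E; apply: le_Rintegral => //.
- by apply: bmeas_integrable; apply: bmeasD => //; exact: bmeas_cmod2.
- apply: bmeas_integrable; apply: bmeas_cmod2; apply: cbmeasD => //.
  have := cbmeasM (cbmeas_cst (-1)) sb.
  by congr cbmeas; apply/funext => x; rewrite mulN1r.
- move=> x _; rewrite /cmod2; case: (h x) (s x) => [a b] [c d] /=.
  have := sqr_ge0 c; have := sqr_ge0 d; rewrite -subr_ge0 => d0 c0.
  rewrite -subr_ge0 (_ : _ - _ = c ^+ 2 + d ^+ 2); last by ring.
  by rewrite addr_ge0 ?sqr_ge0.
Qed.

End BoundedMeasurable.
Arguments bmeas {R} O f.
Arguments cbmeas {R} O f.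
Arguments cint {R} O f.

(** * Damped exponentials and their integrals over an interval *)

Section PieceExponential.
Context {R : realType}.
Local Notation mu := (@lebesgue_measure R).
Implicit Types (a b t w x : R) (f F : R -> R).

(** This is exp((-t + iw)x), in coordinates so that real and imaginary parts can be differentiated
    separately. *)
Definition pexp t w x : R[i] :=
  (expR (- (t * x)) * cos (w * x)) +i* (expR (- (t * x)) * sin (w * x)).

Lemma Rintegral_FTC2 f F a b : a < b -> continuous f ->
  (forall x, is_derive x 1 F (f x)) ->
  Rintegral mu [set x | a < x < b] f = F b - F a.
Proof.
move=> ab cf dF.
have cF : continuous F.
  by move=> x; apply: differentiable_continuous; apply/derivable1_diffP; case: (dF x).
have cwf : {within `[a, b], continuous f} by apply: continuous_subspaceT.
rewrite (_ : [set _ | _] = `]a, b[%classic); last by rewrite set_itvoo.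
rewrite /Rintegral -[X in fine X](@integral_itv_bndoo _ _ _ _ true false); last first.
  by apply/measurable_EFinP; apply: measurable_funTS; exact: continuous_measurable_fun.
rewrite (continuous_FTC2 (F := F)) => //.
- split.
  + by move=> x _; case: (dF x).
  + by apply: cvg_at_right_filter; exact: cF.
  + by apply: cvg_at_left_filter; exact: cF.
- by move=> x _; rewrite derive1E; case: (dF x).
Qed.

Lemma is_derive_expR_cos t w x : is_derive x 1
  (fun x => expR (- (t * x)) * cos (w * x))
  (- t * (expR (- (t * x)) * cos (w * x)) - w * (expR (- (t * x)) * sin (w * x))).
Proof.
apply: is_derive_eq; rewrite /GRing.scale /=; ring.
Qed.

Lemma is_derive_expR_sin t w x : is_derive x 1
  (fun x => expR (- (t * x)) * sin (w * x))
  (- t * (expR (- (t * x)) * sin (w * x)) + w * (expR (- (t * x)) * cos (w * x))).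
Proof.
apply: is_derive_eq; rewrite /GRing.scale /=; ring.
Qed.

Lemma continuous_pexp t w : continuous (fun x => Re (pexp t w x)) /\
  continuous (fun x => Im (pexp t w x)).
Proof.
split=> x; apply: differentiable_continuous; apply/derivable1_diffP.
  by case: (is_derive_expR_cos t w x).
by case: (is_derive_expR_sin t w x).
Qed.

Lemma cbmeas_pexp (O : set R) (M : R) t w : (forall x, O x -> `|x| <= M) ->
  cbmeas O (pexp t w).
Proof.
move=> OM; have [cr ci] := continuous_pexp t w.
have E x : O x -> expR (- (t * x)) <= expR (`|t| * M).
  move=> Ox; rewrite ler_expR (le_trans (ler_norm _))// normrN normrM.
  by rewrite ler_wpM2l// OM.
split; (split; first by apply: measurable_funTS; exact: continuous_measurable_fun);
  exists (expR (`|t| * M)) => x Ox; rewrite normrM (ger0_norm (expR_ge0 _)).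
  by rewrite -[leRHS]mulr1 ler_pM ?expR_ge0 ?E// ler_norml cos_geN1 cos_le1.
by rewrite -[leRHS]mulr1 ler_pM ?expR_ge0 ?E// ler_norml sin_geN1 sin_le1.
Qed.

(** The function [pexp t w] is an eigenfunction of differentiation, so this is the fundamental
    theorem of calculus. With the factor kept on the left, [t = w = 0] is allowed. *)
Lemma cint_pexp t w a b : a < b ->
  (- t +i* w) * cint [set x | a < x < b] (pexp t w) = pexp t w b - pexp t w a.
Proof.
move=> ab; rewrite (_ : [set _ | _] = `]a, b[%classic); last by rewrite set_itvoo.
have Wb : cbmeas `]a, b[%classic (pexp t w).
  apply: (@cbmeas_pexp _ (`|a| + `|b|)) => x /=; rewrite in_itv/= => /andP[ax xb].
  rewrite ler_norml; apply/andP; split.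
    by apply: le_trans (ltW ax); have := ler_norm (-a); have := normr_ge0 b; rewrite normrN; lra.
  by apply: le_trans (ltW xb) _; have := ler_norm b; have := normr_ge0 a; lra.
rewrite -cintZ//; last first.
  by rewrite lebesgue_measure_itv/= lte_fin ab EFinN ltey.
have [cr ci] := continuous_pexp t w.
have dr x : is_derive x 1 (fun x => Re (pexp t w x)) (Re ((- t +i* w) * pexp t w x)).
  exact: is_derive_expR_cos.
have di x : is_derive x 1 (fun x => Im (pexp t w x)) (Im ((- t +i* w) * pexp t w x)).
  exact: is_derive_expR_sin.
have lin (u v : R) (f g : R -> R) : continuous f -> continuous g ->
    continuous (fun x => u * f x + v * g x).
  by move=> cf cg x; apply: cvgD; apply: cvgM; first [exact: cvg_cst|exact: cf|exact: cg].
rewrite /cint -set_itvoo (Rintegral_FTC2 ab _ dr) ?(Rintegral_FTC2 ab _ di)//.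
- exact: lin.
- rewrite (_ : (fun _ => _) =
      fun x => - t * Re (pexp t w x) + - w * Im (pexp t w x)); first exact: lin.
  by apply/funext => x /=; rewrite !mulNr.
Qed.

End PieceExponential.

(** A nonempty open interval has positive measure, so it does not fit into the exceptional null
    set. *)
Lemma ae_itv_exists (R : realType) (P : R -> Prop) (a b : R) :
  {ae @lebesgue_measure R, forall x, P x} -> a < b -> exists2 x, a < x < b & P x.
Proof.
move=> aeP ab; apply: contrapT => nP.
have /negligibleP : (@lebesgue_measure R).-negligible `]a, b[%classic.
  apply: negligibleS aeP => x /=; rewrite in_itv/= => axb Px.
  by apply: nP; exists x.
move=> /(_ (measurable_itv _)) /eqP.
by rewrite [X in X == _]lebesgue_measure_itv/= lte_fin ab -EFinB eqe subr_eq0 gt_eqF.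
Qed.

Lemma cint_chi (R : realType) (O I : set R) (f : R -> R[i]) :
  I `<=` O -> cint O (fun x => (x \in I)%:R * f x) = cint I f.
Proof.
move=> IO; have E : I = O `&` I by apply/esym/setIidPr.
rewrite /cint {3 4}E !Rintegral_mkcondr.
by congr (_ +i* _); apply: eq_Rintegral => x _; rewrite patchE;
  case: (x \in I); rewrite ?mul1r ?mul0r.
Qed.

(** * Completeness of the exponentials *)

Section Density.
Context {R : realType} {O L : set R}.
Local Notation mu := (@lebesgue_measure R).
Hypothesis mO : measurable O.
Hypothesis fO : (mu O < +oo)%E.
Variable M : R.
Hypothesis OM : forall x, O x -> `|x| <= M.

Lemma expeJ (l x : R) : (expe l x)^*%C = pexp 0 (- (2 * pi * l)) x.
Proof.
by rewrite /expe /expi /pexp /= mul0r oppr0 expR0 !mul1r mulNr cosN sinN.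
Qed.

Lemma cbmeas_expe (l : R) : cbmeas O (expe l).
Proof.
have := cbmeasJ (@cbmeas_pexp _ O M 0 (- (2 * pi * l)) OM).
by congr (cbmeas O _); apply/funext => x; rewrite -expeJ conjcK.
Qed.

(** By Pythagoras, every finite combination of the exponentials is at distance at least the norm of
    [h] from [h]. Were that norm positive, density would yield one strictly closer. *)
Lemma spectrum_orthogonal (h : R -> R[i]) : spectrum O L -> cbmeas O h ->
  (forall l, L l -> inner O h (expe l) = 0) ->
  Rintegral mu O (fun x => cmod2 (h x)) = 0.
Proof.
move=> [_ _ dens] hb h0.
set I := Rintegral _ _ _.
have cmod2_ge0 (z : R[i]) : 0 <= cmod2 z by rewrite addr_ge0// sqr_ge0.
have I0 : 0 <= I by apply: Rintegral_ge0 => x _.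
apply/eqP; move: I0; rewrite le_eqVlt => /orP[/eqP <-//|I0].
have hL2 : L2 O h.
  split; [exact: hb.1.1|exact: hb.2.1|].
  have /integrableP[_] := bmeas_integrable mO fO (bmeas_cmod2 hb).
  under eq_integral do rewrite /= ger0_norm//.
  by [].
have sI : 0 < Num.sqrt I by rewrite sqrtr_gt0.
have [s [c [sL]]] := dens h hL2 _ sI.
set k := (_^-1)%:C; pose S x := \sum_(l <- s) c l * (k * expe l x).
have FB l : cbmeas O (fun x => c l * (k * expe l x)).
  by apply: cbmeasM (cbmeasM _ (cbmeas_expe l)); exact: cbmeas_cst.
have SB : cbmeas O S by exact: cbmeas_sum.
rewrite /L2norm ltr_sqrt// ltNge => /negP[].
apply: (Rintegral_cmod2B_ge mO fO hb SB).
rewrite [inner _ _ _](_ : _ =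
  cint O (fun x => \sum_(l <- s) (c l * k)^*%C * (h x * (expe l x)^*%C))).
  rewrite cint_sum//; last first.
    move=> l; apply: cbmeasM; first exact: cbmeas_cst.
    by apply: cbmeasM => //; apply: cbmeasJ; exact: cbmeas_expe.
  rewrite big_seq big1// => l /sL Ll; rewrite cintZ//.
    by rewrite [cint _ _](h0 l Ll) mulr0.
  by apply: cbmeasM => //; apply: cbmeasJ; exact: cbmeas_expe.
rewrite /inner -/(cint O (fun x => h x * (S x)^*%C)); congr (cint O _).
apply/funext => x; rewrite /S rmorph_sum/= mulr_sumr; apply: eq_bigr => l _.
by rewrite !rmorphM/=; ring.
Qed.

End Density.

(** * Piecewise exponential functions on [Omega] *)

Section PiecewiseExponential.
Context {R : realType} {n : nat} {al be : 'I_n -> R} {L : set R}.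
Local Notation mu := (@lebesgue_measure R).
Local Notation Om := (Omega al be).
Local Notation piece i := [set x | al i < x < be i].
Hypothesis al_lt_be : forall i, al i < be i.
Hypothesis be_lt_al : forall i j : 'I_n, (i < j)%N -> be i < al j.

Lemma piece_inj i j x : al i < x < be i -> al j < x < be j -> i = j.
Proof.
move=> /andP[ai bi] /andP[aj bj]; apply/val_inj/eqP => /=.
rewrite eqn_leq; apply/andP; split; rewrite leqNgt; apply/negP => /be_lt_al.
  by move=> /(lt_trans bj)/(lt_trans ai); rewrite ltxx.
by move=> /(lt_trans bi)/(lt_trans aj); rewrite ltxx.
Qed.

Lemma measurable_Omega : measurable Om.
Proof.
apply: fin_bigcup_measurable => [|i _]; first exact: finite_finset.
by rewrite -set_itvoo.
Qed.

Lemma Omega_bounded : exists M, forall x, Om x -> `|x| <= M.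
Proof.
exists (\sum_i (`|al i| + `|be i|)) => x [i _ /andP[ax xb]].
rewrite (bigD1 i)//= -[leLHS]addr0; apply: lerD; last first.
  by apply: sumr_ge0 => j _; rewrite addr_ge0.
have := ler_norm (be i); have := ler_norm (- al i); rewrite normrN => ? ?.
by have := normr_ge0 (be i); have := normr_ge0 (al i); rewrite ler_norml; lra.
Qed.

Lemma Omega_finite : (mu Om < +oo)%E.
Proof.
have [M OM] := Omega_bounded.
have : (mu `[(- M)%R, M]%classic < +oo)%E.
  by rewrite lebesgue_measure_itv/=; case: ifP => // _; rewrite -EFinB ltey.
apply: le_lt_trans; apply: le_measure; rewrite ?inE.
- exact: measurable_Omega.
- exact: measurable_itv.
- by move=> x /OM; rewrite /= in_itv/= ler_norml.
Qed.

(** The sums in the hypothesis are the inner products with [expe l] of the function equal to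
    [c i * expR (- (t * x))] on the i-th piece. That function therefore vanishes almost everywhere,
    and at one point of each piece its positive factor can be cancelled. *)
Lemma piecewise_exp_eq0 (t : R) (c : 'I_n -> R[i]) : spectrum Om L ->
  (forall l, L l -> \sum_i c i * cint (piece i) (pexp t (- (2 * pi * l))) = 0) ->
  forall i, c i = 0.
Proof.
move=> spec c0 i.
have [M OM] := Omega_bounded; have mO := measurable_Omega; have fO := Omega_finite.
pose g j x : R[i] := (x \in piece j)%:R * pexp t 0 x.
pose h x := \sum_j c j * g j x.
have gB j w : cbmeas Om (fun x => (x \in piece j)%:R * pexp t w x).
  apply: cbmeasM; last exact: (cbmeas_pexp (M := M)).
  split; split.
  - rewrite (_ : (fun _ => _) = (\1_(piece j) : R -> R)); last first.
      by apply/funext => x; rewrite indicE; case: (_ \in _).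
    by apply: measurable_indic; rewrite -set_itvoo; exact: measurable_itv.
  - by exists 1 => x _; case: (_ \in _); rewrite /= ?normr0 ?normr1.
  - rewrite (_ : (fun _ => _) = fun=> 0); first exact: measurable_cst.
    by apply/funext => x; case: (_ \in _).
  - by exists 0 => x _; case: (_ \in _); rewrite /= normr0.
have hB : cbmeas Om h.
  by apply: cbmeas_sum => j; apply: cbmeasM; [exact: cbmeas_cst|exact: gB].
have h0 l : L l -> inner Om h (expe l) = 0.
  move=> Ll; rewrite -(c0 l Ll).
  rewrite [inner _ _ _](_ : _ = cint Om (fun x => \sum_j c j *
      ((x \in piece j)%:R * pexp t (- (2 * pi * l)) x))).
    rewrite cint_sum//; last first.
      by move=> j; apply: cbmeasM => //; exact: cbmeas_cst.
    apply: eq_bigr => j _; rewrite cintZ// cint_chi// => x xj.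
    by exists j.
  rewrite /inner -/(cint Om (fun x => h x * (expe l x)^*%C)); congr (cint Om _).
  apply/funext => x; rewrite /h /g mulr_suml; apply: eq_bigr => j _.
  rewrite -(mulrA (c j)) -(mulrA _%:R); congr (_ * (_ * _)); rewrite expeJ /pexp.
  rewrite !mul0r cos0 sin0 oppr0 expR0; apply/eqP; rewrite eq_complex /=.
  by apply/andP; split; apply/eqP; ring.
have := spectrum_orthogonal mO fO OM spec hB h0.
have hI := bmeas_integrable mO fO (bmeas_cmod2 hB).
have cmod2_ge0 (z : R[i]) : 0 <= cmod2 z by rewrite addr_ge0// sqr_ge0.
move=> I0.
have /(ae_eq_integral_abs mu mO (measurable_int mu hI)) : 
    (\int[mu]_(x in Om) `|(EFin \o (fun x => cmod2 (h x))) x| = 0)%E.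
  under eq_integral do rewrite /= ger0_norm//.
  rewrite -[LHS]fineK; first by rewrite -[fine _]/(Rintegral _ _ _) I0.
  exact: integrable_fin_num hI.
move=> /ae_itv_exists /(_ (al_lt_be i)) [x xi hx].
have : cmod2 (h x) = 0 by apply: EFin_inj; apply: hx; exists i.
rewrite /h (bigD1 i)//= big1 => [|j ji]; last first.
  rewrite /g (_ : x \in piece j = false) ?mul0r ?mulr0//.
  by apply/negP => /set_mem /(piece_inj xi) ij; rewrite ij eqxx in ji.
rewrite addr0 /g (_ : x \in piece i = true) ?mul1r; last exact: mem_set.
rewrite /pexp !mul0r cos0 sin0 mulr1 mulr0; have := expR_gt0 (- (t * x)).
case: (c i) => a b; set e := expR _ => e0; rewrite /cmod2 /= !mulr0 subr0 add0r.
move/eqP; rewrite paddr_eq0 ?sqr_ge0// !sqrf_eq0 !mulf_eq0 (gt_eqF e0) !orbF.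
by move=> /andP[/eqP -> /eqP ->].
Qed.

End PiecewiseExponential.

(** * Boundary values of functions in the operator domain *)

Section BoundaryValues.
Context {R : realType}.
Implicit Types (a b l x : R).

Lemma uniformly_continuous_ae_eq (a b : R) (u v : R -> R) :
  (forall e, 0 < e -> exists2 d, 0 < d & forall s t,
    a < s -> s <= t -> t < b -> t - s < d -> `|u t - u s| < e) ->
  continuous v ->
  {ae @lebesgue_measure R, forall x, a < x < b -> v x = u x} ->
  forall x, a < x < b -> u x = v x.
Proof.
move=> uc cv uv x /andP[ax xb]; apply/eqP; rewrite -subr_eq0 -normr_le0 leNgt.
apply/negP => e0; set e := `|_| in e0.
have e20 : 0 < e / 2 by rewrite divr_gt0.
have [d d0 ud] := uc _ e20.
have [d' /= d'0 vd] : \forall y \near x, `|v x - v y| < e / 2.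
  by move: (cv x) => /cvgrPdist_lt; exact.
(* The comparison point [y], where [u] and [v] agree, is taken to the right of [x] because the
   modulus of [u] is stated for [s <= t]. Then [u x] and [v x] are both within [e / 2] of the common
   value. *)
have xm : x < Num.min b (Num.min (x + d) (x + d')) by rewrite !lt_min xb !ltrDl d0.
have [y /andP[xy]] := ae_itv_exists uv xm.
rewrite !lt_min => /and3P[yb yd yd'] vuy.
have := ud x y ax (ltW xy) yb; rewrite ltrBlDl => /(_ yd) h1.
have : `|v x - v y| < e / 2.
  by apply: vd => /=; rewrite distrC ger0_norm ?subr_ge0 ?(ltW xy)// ltrBlDl.
rewrite vuy ?(lt_trans ax xy)// => h2.
have : e < e / 2 + e / 2.
  rewrite {1}/e -(subrKA (u y)) (le_lt_trans (ler_normD _ _))//.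
  by rewrite ltrD// distrC.
by rewrite -splitr ltxx.
Qed.

Lemma abs_continuous_ae_eq (a b : R) (g f : R -> R[i]) :
  abs_continuous_itvoo a b g ->
  continuous (fun x => Re (f x)) -> continuous (fun x => Im (f x)) ->
  {ae @lebesgue_measure R, forall x, a < x < b -> f x = g x} ->
  forall x, a < x < b -> g x = f x.
Proof.
move=> ac cr ci fg x xab.
have uc e : 0 < e -> exists2 d, 0 < d & forall s t,
    a < s -> s <= t -> t < b -> t - s < d -> cmod (g t - g s) < e.
  move=> e0; have [d d0 gd] := ac e e0; exists d => // s t as_ st tb tsd.
  (* Absolute continuity for a family of a single interval is uniform continuity. *)
  have := gd 1%N (fun=> s) (fun=> t); rewrite !big_ord1; apply => //.
  by move=> k j; rewrite !ord1 eqxx.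
have Re_cmod (z : R[i]) : `|Re z| <= cmod z.
  by rewrite -sqrtr_sqr ler_wsqrtr// lerDl sqr_ge0.
have Im_cmod (z : R[i]) : `|Im z| <= cmod z.
  by rewrite -sqrtr_sqr ler_wsqrtr// lerDr sqr_ge0.
apply/eqP; rewrite eq_complex; apply/andP; split; apply/eqP.
- apply: (uniformly_continuous_ae_eq (u := fun x => Re (g x)) _ cr _ xab).
    move=> e /uc[d d0 gd]; exists d => // s t as_ st tb tsd.
    apply: le_lt_trans (gd s t as_ st tb tsd).
    by apply: le_trans (Re_cmod _); case: (g t) (g s) => [? ?] [].
  by apply: negligibleS fg => y /= nP Py; apply: nP => /Py ->.
- apply: (uniformly_continuous_ae_eq (u := fun x => Im (g x)) _ ci _ xab).
    move=> e /uc[d d0 gd]; exists d => // s t as_ st tb tsd.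
    apply: le_lt_trans (gd s t as_ st tb tsd).
    by apply: le_trans (Im_cmod _); case: (g t) (g s) => [? ?] [].
  by apply: negligibleS fg => y /= nP Py; apply: nP => /Py ->.
Qed.

Lemma right_limE (a b : R) (g f : R -> R[i]) : a < b ->
  continuous (fun x => Re (f x)) -> continuous (fun x => Im (f x)) ->
  (forall x, a < x < b -> g x = f x) -> right_lim g a = f a.
Proof.
move=> ab cr ci gf; rewrite /right_lim.
have nab : \forall x \near a^'+, g x = f x.
  near=> x; apply: gf; apply/andP; split; near: x.
    exact: nbhs_right_gt.
  exact: nbhs_right_lt.
rewrite [X in X +i* _](_ : _ = Re (f a)) 1?[X in _ +i* X](_ : _ = Im (f a)).
- by case: (f a).
- apply: cvg_lim => //; apply: cvg_trans (cvg_at_right_filter (ci a)).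
  by apply: near_eq_cvg; apply: filterS nab => x ->.
- apply: cvg_lim => //; apply: cvg_trans (cvg_at_right_filter (cr a)).
  by apply: near_eq_cvg; apply: filterS nab => x ->.
Unshelve. all: by end_near. Qed.

Lemma left_limE (a b : R) (g f : R -> R[i]) : a < b ->
  continuous (fun x => Re (f x)) -> continuous (fun x => Im (f x)) ->
  (forall x, a < x < b -> g x = f x) -> left_lim g b = f b.
Proof.
move=> ab cr ci gf; rewrite /left_lim.
have nab : \forall x \near b^'-, g x = f x.
  near=> x; apply: gf; apply/andP; split; near: x.
    exact: nbhs_left_gt.
  exact: nbhs_left_lt.
rewrite [X in X +i* _](_ : _ = Re (f b)) 1?[X in _ +i* X](_ : _ = Im (f b)).
- by case: (f b).
- apply: cvg_lim => //; apply: cvg_trans (cvg_at_left_filter (ci b)).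
  by apply: near_eq_cvg; apply: filterS nab => x ->.
- apply: cvg_lim => //; apply: cvg_trans (cvg_at_left_filter (cr b)).
  by apply: near_eq_cvg; apply: filterS nab => x ->.
Unshelve. all: by end_near. Qed.

(** The representative [g] of [expe l] provided by [domain_matrix] equals [expe l] almost
    everywhere. Both are continuous on each interval, so they agree there and share their one-sided
    limits. *)
Lemma spectral_matrix_expe (n : nat) (al be : 'I_n -> R) (L : set R)
    (B : 'M[R[i]]_n) (l : R) :
  (forall i, al i < be i) -> spectral_matrix al be L B -> L l ->
  forall i, \sum_j B i j * expe l (al j) = expe l (be i).
Proof.
move=> al_lt_be [A [[[_ sA] Ael] _ dB]] Ll i.
have Al := Ael _ Ll.
(* The graph of the adjoint includes square integrability, so [A = A^*] provides it for [expe l]. *)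
have /sA[L2e _ _] := Al.
have /(dB _ L2e)[g [[_ gac _] Bg eg]] : op_domain A (expe l) by exists (fun x => l%:C * expe l x).
have cr : continuous (fun x => Re (expe l x)).
  move=> x; apply: (@continuous_comp _ _ _ (fun x => 2 * pi * l * x) cos).
    by apply: cvgM; [exact: cvg_cst|exact: cvg_id].
  exact: continuous_cos.
have ci : continuous (fun x => Im (expe l x)).
  move=> x; apply: (@continuous_comp _ _ _ (fun x => 2 * pi * l * x) sin).
    by apply: cvgM; [exact: cvg_cst|exact: cvg_id].
  exact: continuous_sin.
have gE j x : al j < x < be j -> g x = expe l x.
  apply: abs_continuous_ae_eq => //.
  by apply: negligibleS eg => y /= nP Py; apply: nP => yj; apply: Py; exists j.
have := congr1 (fun M : 'cV_n => M i 0) Bg.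
rewrite !mxE (left_limE (al_lt_be i) cr ci (gE i)) => <-.
by apply: eq_bigr => j _; rewrite mxE (right_limE (al_lt_be j) cr ci (gE j)).
Qed.

End BoundaryValues.

(** * Characters of the line and congruence *)

Section Characters.
Context {R : realType}.
Implicit Types (a b l p r x : R).

Lemma expiD a b : expi (a + b) = expi a * expi b.
Proof.
by rewrite /expi cosD sinD; apply/eqP; rewrite eq_complex /= eqxx addrC eqxx.
Qed.

Lemma expiN a : expi (- a) = (expi a)^*%C.
Proof. by rewrite /expi cosN sinN. Qed.

Lemma expi0 : expi 0 = 1 :> R[i].
Proof. by rewrite /expi cos0 sin0. Qed.

Lemma expi_mulJ a : expi a * (expi a)^*%C = 1.
Proof. by rewrite -expiN -expiD subrr expi0. Qed.

Lemma expeD l p x : expe (l + p) x = expe l x * expe p x.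
Proof. by rewrite /expe -expiD; congr expi; ring. Qed.

(** As cosine is even, [r] may be taken nonnegative and reduced to its fractional part s. The
    duplication formula then gives sin(pi s) = 0, while sine is positive on the open interval from 0
    to pi. *)
Lemma cos_eq1_int r : cos (2 * pi * r) = 1 -> r \is a Num.int.
Proof.
wlog r0 : r / 0 <= r.
  move=> H c1; have [/H|/ltW r0] := leP 0 r; first exact.
  by rewrite -rpredN; apply: H; rewrite ?oppr_ge0// mulrN cosN.
have := truncn_itv r0; move: (Num.truncn r) => m /andP[mr rm].
have E (q : R) : 2 * q * r = q * (r - m%:R) *+ 2 + (q *+ 2) *+ m.
  by rewrite -[_ *+ m]mulr_natr !mulr2n; ring.
rewrite E (periodicn (@cosD2pi R)) mulr2n cosD -!expr2 => c1.
have : sin (pi * (r - m%:R)) = 0.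
  apply/eqP; rewrite -sqrf_eq0; apply/eqP.
  by have := cos2Dsin2 (pi * (r - m%:R)); move: c1; lra.
move: mr; rewrite -subr_ge0 le_eqVlt => /orP[/eqP|s0].
  by move=> /esym /eqP; rewrite subr_eq0 => /eqP -> _; exact: natr_int.
have : 0 < sin (pi * (r - m%:R)).
  apply: sin_gt0_pi; rewrite mulr_gt0 ?pi_gt0//=.
  by rewrite gtr_pMr ?pi_gt0// ltrBlDl natr1.
by move=> /[swap] ->; rewrite ltxx.
Qed.

Lemma expe_eq_eqv p a b : expe p a = expe p b -> eqv p a b.
Proof.
move=> ab; apply: cos_eq1_int.
rewrite (_ : 2 * pi * (p * (a - b)) = 2 * pi * p * a - 2 * pi * p * b); last by ring.
suff : expi (2 * pi * p * a - 2 * pi * p * b) = 1 by case.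
by rewrite expiD expiN -[expi _]/(expe p a) ab expi_mulJ.
Qed.

Lemma eqv_sym p a b : eqv p a b = eqv p b a.
Proof. by rewrite /eqv -rpredN -mulrN opprB. Qed.

Lemma eqv_trans p a b c : eqv p a b -> eqv p b c -> eqv p a c.
Proof.
rewrite /eqv => ab bc; rewrite (_ : _ * _ = p * (a - b) + p * (b - c)); last by ring.
exact: rpredD.
Qed.

Lemma pexpE t l x :
  pexp t (- (2 * pi * l)) x = (expR (- (t * x)))%:C * (expe l x)^*%C.
Proof.
rewrite expeJ /pexp mul0r oppr0 expR0; apply/eqP; rewrite eq_complex /=.
by apply/andP; split; apply/eqP; ring.
Qed.

End Characters.

(** * Spanning by boundary vectors, zeros of [B], and the adjoint relations *)

Section SpectralMatrix.
Context {R : realType} {n : nat} {al be : 'I_n -> R} {L : set R} {B : 'M[R[i]]_n}.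
Hypothesis al_lt_be : forall i, al i < be i.
Hypothesis be_lt_al : forall i j : 'I_n, (i < j)%N -> be i < al j.
Hypothesis specL : spectrum (Omega al be) L.
Hypothesis BU : B \is unitarymx.
Hypothesis Be : forall l, L l -> forall i,
  \sum_j B i j * expe l (al j) = expe l (be i).

(** By [cint_pexp] the integrals are boundary differences divided by the exponent. The exponent
    vanishes only for [t = l = 0]; the integrals are then the interval lengths, hence the second
    hypothesis. *)
Lemma boundary_eq0 (t : R) (c : 'I_n -> R[i]) :
  (forall l, L l -> \sum_i c i * (pexp t (- (2 * pi * l)) (be i) -
                                  pexp t (- (2 * pi * l)) (al i)) = 0) ->
  (t = 0 -> \sum_i c i * (be i - al i)%:C = 0) ->
  forall i, c i = 0.
Proof.
move=> bd mean; apply: (piecewise_exp_eq0 (t := t) al_lt_be be_lt_al specL) => l Ll.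
have [/eqP|z0] := eqVneq (- t +i* - (2 * pi * l)) 0.
  rewrite eq_complex /= !oppr_eq0 => /andP[/eqP t0 /eqP l0].
  rewrite -[RHS](mean t0); apply: eq_bigr => i _; congr (_ * _).
  rewrite t0 l0 oppr0 /cint /pexp.
  rewrite -set_itvoo; apply/eqP; rewrite eq_complex /=; apply/andP; split; apply/eqP.
    under eq_Rintegral do rewrite !mul0r oppr0 expR0 cos0 mulr1.
    rewrite Rintegral_cst//= lebesgue_measure_itv/= lte_fin al_lt_be.
    by rewrite mul1r.
  under eq_Rintegral do rewrite !mul0r sin0 mulr0.
  by rewrite Rintegral_cst//= mul0r.
apply: (mulfI z0); rewrite mulr0 -[RHS](bd l Ll) mulr_sumr.
by apply: eq_bigr => i _; rewrite mulrCA cint_pexp.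
Qed.

(* With exponential weights, [c |-> c (E_be B^- - E_al)] is injective since
   [|c E_be| < |c E_al|]; hence any [w] orthogonal to the boundary values comes
   from a piecewise exponential orthogonal to all of [L]. *)
Lemma boundary_values_span (w : 'I_n -> R[i]) :
  (forall l, L l -> \sum_j w j * expe l (al j) = 0) -> forall j, w j = 0.
Proof.
move=> w0.
pose E (x : R) : R[i] := (expR (- (1 * x)))%:C.
(* Once e_l(be) is replaced by B e_l(al), the boundary term of coefficients [c] is [c *m M] paired
   with the conjugates of [expe l (al j)]. *)
pose M := \matrix_(i, j) (E (be i) * (B i j)^*%C - (i == j)%:R * E (al i)).
have Munit : M \in unitmx.
  rewrite unitmxE unitfE; apply/det0P => -[v v0 vM].
  pose u : 'rV[R[i]]_n := \row_i (v 0 i * E (be i)).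
  pose Bc : 'M[R[i]]_n := map_mx Num.conj B.
  have BcU : Bc \is unitarymx.
    rewrite (_ : Bc = (map_mx Num.conj B^T)^T) ?trmx_unitary ?trmxC_unitary//.
    by apply/matrixP => i j; rewrite !mxE.
  have uB j : (u *m Bc) 0 j = v 0 j * E (al j).
    have /matrixP/(_ 0 j) := vM; rewrite !mxE.
    under eq_bigr do rewrite mxE mulrBr.
    rewrite sumrB => /eqP; rewrite subr_eq0 => /eqP.
    rewrite [X in _ = X](bigD1 j)//= eqxx mul1r [X in _ + X]big1; last first.
      by move=> i /negPf ->; rewrite mul0r mulr0.
    rewrite addr0 => <-; apply: eq_bigr => i _; by rewrite !mxE mulrA.
  (* A unitary matrix preserves the norm of [u]. In terms of [v] this is a vanishing sum of the
     [|v 0 i| ^+ 2] with positive weights, because [al i < be i]. *)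
  have : u *m Bc *m map_mx Num.conj (u *m Bc)^T = u *m map_mx Num.conj u^T.
    rewrite trmx_mul map_mxM -mulmxA (mulmxA Bc).
    by rewrite (unitarymxP BcU) mul1mx.
  move=> /matrixP/(_ 0 0); rewrite !mxE => /eqP.
  rewrite -subr_eq0 -sumrB.
  have nE (z : R[i]) (r : R) : 0 <= r -> `|z * r%:C| ^+ 2 = `|z| ^+ 2 * (r ^+ 2)%:C.
    by move=> r0; rewrite normrM exprMn (ger0_norm (_ : 0 <= r%:C)) ?ler0c// rmorphXn.
  have termE i : (u *m Bc) 0 i * map_mx Num.conj (u *m Bc)^T i 0 -
      u 0 i * map_mx Num.conj u^T i 0 =
      `|v 0 i| ^+ 2 * (expR (- al i) ^+ 2 - expR (- be i) ^+ 2)%:C.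
    rewrite ![map_mx _ _ _ _]mxE ![_^T _ _]mxE -!normCK uB /u mxE /E !mul1r.
    by rewrite !nE ?expR_ge0// -mulrBr rmorphB.
  have pos i : 0 < (expR (- al i) ^+ 2 - expR (- be i) ^+ 2)%:C.
    rewrite ltcR subr_gt0 ltr_pXn2r// ?nnegrE ?expR_ge0//.
    by rewrite ltr_expR ltrN2.
  under eq_bigr do rewrite termE.
  rewrite psumr_eq0 => [/allP h|i _]; last first.
    by rewrite mulr_ge0 ?exprn_ge0// ltW.
  move/negP: v0; apply; apply/eqP/rowP => i; rewrite mxE; apply/eqP.
  have := h i (mem_index_enum i); rewrite mulf_eq0 (gt_eqF (pos i)) orbF.
  by rewrite sqrf_eq0 normr_eq0.
(* With this choice the boundary terms of [c] are the conjugates of the sums assumed to vanish. *)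
pose c := (\row_j (w j)^*%C) *m invmx M.
have cM : c *m M = \row_j (w j)^*%C by rewrite mulmxKV.
have c0 : forall i, c 0 i = 0.
  apply: (@boundary_eq0 1) => [l Ll|/eqP]; last by rewrite oner_eq0.
  transitivity ((\sum_j w j * expe l (al j))^*%C); last by rewrite w0// conjc0.
  rewrite rmorph_sum/=.
  transitivity (\sum_j (c *m M) 0 j * (expe l (al j))^*%C); last first.
    by apply: eq_bigr => j _; rewrite cM mxE rmorphM.
  under [RHS]eq_bigr do rewrite mxE mulr_suml.
  rewrite exchange_big/=; apply: eq_bigr => i _.
  under [RHS]eq_bigr do rewrite -mulrA.
  rewrite -mulr_sumr !pexpE -(Be Ll) rmorph_sum/=; congr (_ * _).
  under [RHS]eq_bigr do rewrite mxE mulrBl.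
  rewrite sumrB; congr (_ - _).
    by rewrite mulr_sumr; apply: eq_bigr => j _; rewrite rmorphM mulrA.
  rewrite (bigD1 i)//= eqxx /E !mul1r big1 ?addr0// => j /negPf ij.
  by rewrite eq_sym ij !mul0r.
move=> j; have /rowP/(_ j) := cM; rewrite !mxE big1 => [|i _]; last by rewrite c0 mul0r.
by move=> /esym/eqP; rewrite conjc_eq0 => /eqP.
Qed.

(** Row i of B diag(e_p(al)) - diag(e_p(be)) B annihilates the spanning boundary vectors, hence is
    zero. A nonzero [B i j] then makes [expe p] equal at [al j] and [be i], which is congruence. *)
Lemma spectral_matrix_eq0 p : has_period L p ->
  forall i j, ~~ eqv p (al j) (be i) -> B i j = 0.
Proof.
move=> [_ Lp] i j nij.
have : B i j * (expe p (al j) - expe p (be i)) = 0.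
  apply: (@boundary_values_span (fun j => B i j * (expe p (al j) - expe p (be i)))).
  move=> l Ll; have Llp : L (l + p) by rewrite -Lp; exists l.
  under eq_bigr do rewrite mulrBr mulrBl.
  rewrite sumrB; apply/eqP; rewrite subr_eq0; apply/eqP.
  transitivity (expe (l + p) (be i)).
    rewrite -Be//; apply: eq_bigr => k _; rewrite expeD; ring.
  rewrite expeD -Be// mulr_suml; apply: eq_bigr => k _; ring.
move=> /eqP; rewrite mulf_eq0 => /orP[/eqP//|]; rewrite subr_eq0 => /eqP/expe_eq_eqv.
by rewrite (negPf nij).
Qed.

(** Unitarity turns B e_l(al) = e_l(be) into B^* e_l(be) = e_l(al); this is its conjugate, the
    source of the column sums. *)
Lemma spectral_matrix_expeV l : L l -> forall j,
  \sum_i B i j * (expe l (be i))^*%C = (expe l (al j))^*%C.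
Proof.
move=> Ll j; pose x : 'cV[R[i]]_n := \col_j expe l (al j).
pose y : 'cV[R[i]]_n := \col_j expe l (be j).
have yE : y = B *m x.
  by apply/colP => i; rewrite !mxE -Be//; apply: eq_bigr => k _; rewrite mxE.
have : map_mx Num.conj B^T *m y = x.
  by rewrite yE mulmxA -invmx_unitary// mulVmx ?mul1mx// unitarymx_unit.
move=> /colP/(_ j); rewrite !mxE => <-; rewrite rmorph_sum; apply: eq_bigr => i _.
by rewrite !mxE rmorphM/=; congr (_ * _); rewrite -[RHS]/((B i j)^*%C^*%C) conjcK.
Qed.

End SpectralMatrix.

(** * Fixed vectors of [B] and irreducibility *)

Section Irreducibility.
Context {R : realType} {n : nat} {al be : 'I_n -> R} {L : set R} {B : 'M[R[i]]_n}.
Hypothesis al_lt_be : forall i, al i < be i.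
Hypothesis be_lt_al : forall i j : 'I_n, (i < j)%N -> be i < al j.
Hypothesis specL : spectrum (Omega al be) L.
Hypothesis BU : B \is unitarymx.
Hypothesis Be : forall l, L l -> forall i,
  \sum_j B i j * expe l (al j) = expe l (be i).

(* A fixed vector of [B] is the family of values of a locally constant function
   in the kernel of the operator, which is spanned by [1]; its mean vanishing
   makes it orthogonal to [1]. *)
Lemma fixed_vector_eq0 (c : 'I_n -> R[i]) :
  (forall i, \sum_j B i j * c j = c i) -> \sum_i c i * (be i - al i)%:C = 0 ->
  forall i, c i = 0.
Proof.
move=> Bc mean.
apply: (boundary_eq0 (t := 0) al_lt_be be_lt_al specL _ (fun=> mean)) => l Ll.
under eq_bigr do rewrite !pexpE !mul0r oppr0 expR0 mul1r mul1r mulrBr.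
rewrite sumrB; apply/eqP; rewrite subr_eq0; apply/eqP.
(* The column relation moves [B] from the exponentials onto [c], where [Bc] absorbs it. *)
under [RHS]eq_bigr do rewrite -(spectral_matrix_expeV BU Be Ll) mulr_sumr.
rewrite exchange_big/=; apply: eq_bigr => i _.
rewrite -{1}Bc mulr_suml; apply: eq_bigr => j _; ring.
Qed.

Lemma spectral_matrix_irreducible (I : {set 'I_n}) :
  (forall i, \sum_j B i j = 1) ->
  (forall i j, i \in I -> j \notin I -> B i j = 0) ->
  (forall i j, i \notin I -> j \in I -> B i j = 0) ->
  I = finset.set0 \/ I = finset.setT.
Proof.
move=> B1 B01 B10.
have [I0|/set0Pn[i0 i0I]] := eqVneq I finset.set0; first by left.
right; apply/finset.setP => k; rewrite finset.in_setT; apply: contraT => kI.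
pose len i : R := be i - al i.
have len_gt0 i : 0 < len i by rewrite subr_gt0.
pose a := \sum_(i in I) len i; pose b := \sum_(i | i \notin I) len i.
(* Each block carries, up to sign, the total length of the other one, so the mean is a b - a b = 0.
   Constancy on the blocks and row sums 1 make [c] a fixed vector. *)
pose c i : R[i] := if i \in I then b%:C else - a%:C.
have b0 : 0 < b.
  by rewrite /b (bigD1 k)//= ltr_pwDl// sumr_ge0// => i _; rewrite ltW.
have : c i0 = 0.
  apply: (fixed_vector_eq0 (c := c)) => [i|].
    rewrite -[RHS]mul1r -(B1 i) mulr_suml; apply: eq_bigr => j _.
    rewrite /c; case: (boolP (i \in I)) => iI; case: (boolP (j \in I)) => jI //.
      by rewrite B01// !mul0r.
    by rewrite B10// !mul0r.
  rewrite (bigID (mem I))/=.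
  under eq_bigr => i iI do rewrite /c iI.
  under [X in _ + X]eq_bigr => i iI do rewrite /c (negPf iI).
  rewrite -!mulr_sumr -!(rmorph_sum (real_complex R))/=.
  by rewrite -/a -/b mulNr mulrC subrr.
rewrite /c i0I => -[] b00; by rewrite b00 ltxx in b0.
Qed.

End Irreducibility.

(** * The permutation from the determinant, and the assembly of the properties *)

Lemma unitmx_perm_neq0 (F : fieldType) (n : nat) (A : 'M[F]_n) :
  A \in unitmx -> exists s : 'S_n, forall i, A i (s i) != 0.
Proof.
rewrite unitmxE unitfE => dA.
have /existsP[s] : [exists s : 'S_n, \prod_i A i (s i) != 0].
  apply: contraNT dA; rewrite negb_exists => /forallP A0.
  by rewrite /determinant big1// => s _; move: (A0 s); rewrite negbK => /eqP ->; rewrite mulr0.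
by move=> /prodf_neq0 As; exists s => i; exact: As.
Qed.

Theorem theorem4p9 (R : realType) (n : nat) (al be : 'I_n -> R)
    (L : set R) (p : R) (B : 'M[R[i]]_n)
    (n_gt0 : (0 < n)%N)
    (al_lt_be : forall i, al i < be i)
    (be_lt_al : forall i j : 'I_n, (i < j)%N -> be i < al j)
    (specL : spectrum (Omega al be) L)
    (perL : has_period L p)
    (L0 : L 0)
    (specB : spectral_matrix al be L B) :
  (exists sigma : 'S_n, forall i, eqv p (be i) (al (sigma i))) /\
  (forall i j, ~~ eqv p (al j) (be i) -> B i j = 0) /\
  (forall i, \sum_(j | eqv p (al j) (be i)) B i j = 1) /\
  (forall j, \sum_(i | eqv p (be i) (al j)) B i j = 1) /\
  (forall l, L l -> forall i,
     \sum_(j | eqv p (al j) (be i))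
       expi (- (2 * pi * (be i - al j) * l)) * B i j = 1) /\
  (forall l, L l -> forall j,
     \sum_(i | eqv p (be i) (al j))
       expi (- (2 * pi * (be i - al j) * l)) * B i j = 1) /\
  ~ (exists I : {set 'I_n}, [/\ I != finset.set0, I != finset.setT &
       forall i j, i \in I -> j \notin I -> ~~ eqv p (be i) (al j)]).
Proof.
have [A [_ BU _]] := specB.
have Be l : L l -> forall i, \sum_j B i j * expe l (al j) = expe l (be i).
  exact: spectral_matrix_expe.
have B0 := spectral_matrix_eq0 al_lt_be be_lt_al specL BU Be perL.
have expiE l i j : expi (- (2 * pi * (be i - al j) * l)) =
    expe l (al j) * (expe l (be i))^*%C.
  by rewrite /expe -expiN -expiD; congr expi; ring.
have rowE l : L l -> forall i, \sum_(j | eqv p (al j) (be i))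
    expi (- (2 * pi * (be i - al j) * l)) * B i j = 1.
  (* The number 1 is split as [expe l (be i)] times its conjugate, and the first factor is expanded
     along row i; entries outside the congruence class are zero. *)
  move=> Ll i; rewrite -[RHS](expi_mulJ (2 * pi * l * be i)) -/(expe l (be i)).
  rewrite -{1}Be// mulr_suml [LHS]big_mkcond/=; apply: eq_bigr => j _.
  by case: ifP => [_|/negbT/B0 ->]; rewrite ?mul0r// expiE mulrC mulrA.
have colE l : L l -> forall j, \sum_(i | eqv p (be i) (al j))
    expi (- (2 * pi * (be i - al j) * l)) * B i j = 1.
  move=> Ll j; rewrite -[RHS](expi_mulJ (2 * pi * l * al j)) -/(expe l (al j)).
  rewrite -(spectral_matrix_expeV BU Be Ll) mulr_sumr [LHS]big_mkcond/=.
  apply: eq_bigr => i _; rewrite eqv_sym.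
  by case: ifP => [_|/negbT/B0 ->]; rewrite ?mul0r ?mulr0// expiE mulrAC mulrA.
(* At the spectral point 0 all exponential weights are 1. *)
have row1 i : \sum_(j | eqv p (al j) (be i)) B i j = 1.
  rewrite -[RHS](rowE 0 L0 i); apply: eq_bigr => j _.
  by rewrite mulr0 oppr0 expi0 mul1r.
have [s Bs] := unitmx_perm_neq0 (unitarymx_unit BU).
have sE i : eqv p (be i) (al (s i)).
  by rewrite eqv_sym; apply: contraNT (Bs i) => /B0 ->.
do 6?split => //; first by exists s.
  move=> j; rewrite -[RHS](colE 0 L0 j); apply: eq_bigr => i _.
  by rewrite mulr0 oppr0 expi0 mul1r.
case=> I [I0 IT noI].
have sI i : i \in I -> s i \in I.
  by move=> iI; apply: contraT => /(noI _ _ iI); rewrite sE.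
(* [s] permutes [I], so the complement of [I] is isolated as well. *)
have sIE : s @: I = I.
  apply/eqP; rewrite eqEcard card_imset ?leqnn ?andbT; last exact: perm_inj.
  by apply/fintype.subsetP => _ /imsetP[i iI ->]; exact: sI.
have sIV i : (s i \in I) = (i \in I).
  by rewrite -{1}sIE mem_imset//; exact: perm_inj.
suff : I = finset.set0 \/ I = finset.setT by case=> /eqP; apply/negP.
apply: (spectral_matrix_irreducible al_lt_be be_lt_al specL BU Be).
- move=> i; rewrite -[RHS](row1 i) [RHS]big_mkcond/=; apply: eq_bigr => j _.
  by case: ifP => // /negbT/B0.
- move=> i j iI jI; apply: B0; rewrite eqv_sym; exact: noI.
- move=> i j iI jI; apply: B0; apply/negP => ji.
  (* Writing [j = s k] with [k] in [I], the chain from [be k] through [al j] and [be i] to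
     [al (s i)] contradicts the isolation of [I], as [s i] lies outside [I]. *)
  have /imsetP[k kI jk] : j \in s @: I by rewrite sIE.
  have := noI k (s i) kI; rewrite sIV => /(_ iI) /negP; apply.
  by apply: eqv_trans (sE i); apply: eqv_trans ji; rewrite jk.
Qed.
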